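(* Let $d$ be a square-free positive integer, let $K=\mathbb{Q}(\sqrt{-d})$ with ring of integers $\mathcal{O}_K$, and let $\ell$ be a square-free positive integer. There exists an Arakelov-modular lattice of level $\ell$ of trace type over $K$ if and only if $\ell=d$. Moreover, $(I,1)$, where \[ I=\begin{cases}\mathfrak{P}_2^{-1} & d\equiv 1,2 \pmod 4,\\ \mathcal{O}_K & d\equiv 3\pmod 4,\end{cases} \] is an Arakelov-modular lattice of level $d$. Here, for $d\equiv 1,2\pmod 4$, $\mathfrak{P}_2$ is the unique prime ideal of $\mathcal{O}_K$ above $2$.
   Context: The bar denotes complex conjugation on $K$. An element $\alpha\in K^\times$ is totally positive if $\sigma(\alpha)$ is real and $>0$ for every $\sigma\in\mathrm{Gal}(K/\mathbb{Q})$. An ideal lattice over $K$ is a pair $(I,\alpha)$, where $I$ is a (nonzero) fractional $\mathcal{O}_K$-ideal, $\alpha\in K^\times$ is totally positive, and $I$ carries the positive definite symmetric bilinear form $b_\alpha(x,y)=\mathrm{Tr}_{K/\mathbb{Q}}(\alpha x\bar{y})$. Its dual is $(I^*,\alpha)$ with $I^*=\alpha^{-1}\mathcal{D}_K^{-1}\bar{I}^{-1}=\{x\in K: b_\alpha(x,y)\in\mathbb{Z}\ \forall y\in I\}$, where $\mathcal{D}_K$ is the different of $K/\mathbb{Q}$. For a positive integer $\ell$, $(I,\alpha)$ is Arakelov-modular of level $\ell$ if there exists $\beta\in K^\times$ such that $I=\beta I^*$ and $\ell=\beta\bar{\beta}$. It is of trace type if $\alpha=1$. *)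

(* Defs.v *)
From mathcomp Require Import all_boot all_order all_algebra all_fingroup all_field.
From mathcomp Require Import boolp classical_sets.

Set Implicit Arguments.
Unset Strict Implicit.
Unset Printing Implicit Defensive.

Import Order.TTheory GRing.Theory Num.Theory.
Local Open Scope classical_set_scope.
Local Open Scope ring_scope.

Definition square_free (n : nat) : Prop :=
  forall k : nat, (k ^ 2 %| n)%N -> k = 1%N.

(* A Galois number field K is a splittingFieldType over rat. The inclusion of
   K in the complex numbers is given by an embedding iota into algC; in algC,
   0 < z means that z is real and positive. *)
Section IdealLattices.

Variables (K : splittingFieldType rat) (iota : {rmorphism K -> algC}).
Implicit Types (I P : set K) (alpha beta x y : K).

Definition conjK : {lrmorphism K -> K} :=
  sval (restrict_aut_to_normal_num_field iota Num.conj).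

Lemma conjKE x : iota (conjK x) = (iota x)^*.
Proof. exact: svalP (restrict_aut_to_normal_num_field iota Num.conj) x. Qed.

Definition totally_positive alpha : Prop :=
  forall s, s \in 'Gal({:K} / 1)%g -> 0 < iota (s alpha).

Definition ring_of_integers : set K :=
  [set x | integralOver (intr : int -> K) x].

Definition OK_submodule I : Prop :=
  [/\ I 0,
      forall x y, I x -> I y -> I (x + y) &
      forall a x, ring_of_integers a -> I x -> I (a * x)].

Definition fractional_ideal I : Prop :=
  [/\ OK_submodule I,
      exists2 x, I x & x != 0 &
      exists2 c, ring_of_integers c /\ c != 0 &
        forall x, I x -> ring_of_integers (c * x)].

Definition inv_ideal I : set K :=
  [set x | forall y, I y -> ring_of_integers (x * y)].

Definition prime_ideal P : Prop :=
  [/\ OK_submodule P,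
      P `<=` ring_of_integers,
      ~ P 1 &
      forall x y, ring_of_integers x -> ring_of_integers y ->
        P (x * y) -> P x \/ P y].

Definition prime_ideal_above (p : nat) P : Prop :=
  prime_ideal P /\ forall n : int, P n%:~R <-> (p%:Z %| n)%Z.

(* The trace K -> rat, with its value seen in K. *)
Definition trace_form alpha x y : K :=
  galTrace 1 {:K} (alpha * x * conjK y).

Definition ideal_lattice I alpha : Prop :=
  [/\ fractional_ideal I, alpha != 0 & totally_positive alpha].

Definition dual_ideal I alpha : set K :=
  [set x | forall y, I y -> exists n : int, trace_form alpha x y = n%:~R].

Definition Arakelov_modular (l : nat) I alpha : Prop :=
  ideal_lattice I alpha /\
  exists beta,
    [/\ beta != 0,
        I = [set beta * x | x in dual_ideal I alpha] &
        l%:R = beta * conjK beta].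

End IdealLattices.

(* Main.v *)
Require Import Defs.
From mathcomp Require Import all_boot all_order all_algebra all_fingroup all_field.
From mathcomp Require Import boolp classical_sets.
From mathcomp Require Import ring lra zify.

Import Order.TTheory GRing.Theory Num.Theory.
Local Open Scope classical_set_scope.
Local Open Scope ring_scope.

Set Implicit Arguments.
Unset Strict Implicit.
Unset Printing Implicit Defensive.

(** Write s for the square root of -d generating K, and x' for the complex
conjugate of x; then K has Q-basis (1, s) and the trace form is x y' + x' y.

The whole proof rests on one description of the dual.  A fractional ideal I has
a Z-basis (u, v) ([fractional_ideal_basis]); put w = u v' - u' v, which is a
nonzero rational multiple r s of s.  Solving the two linear equations that say
that x pairs to given integers with u and v shows that I^* = w^-1 I
([dual_latticeE]).

Necessity of l = d.  If I = beta I^* with beta beta' = l, then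
(w / beta) I = I.  A multiplier of I has integral norm, since that norm is the
determinant of the integer matrix of the multiplication in the basis (u, v)
([lattice_stable_norm]); applied to w / beta and to its inverse, this gives
that w / beta has norm 1.  Hence l = w w' = r ^ 2 d, and two square-free
numbers whose quotient is a rational square are equal
([Arakelov_modular_level]).

Sufficiency.  For a fractional ideal of the form Z + Z om with om - om' = s one
has w = -s, so that beta = -s works, with norm d ([Arakelov_modular_lattice]).
When d is 3 modulo 4 the ring of integers is such an ideal, with
om = (1 + s) / 2.  When d is 1 or 2 modulo 4, let t be d modulo 2; then
2 Z + (t + s) Z is the only prime above 2 ([P2_unique]) and its inverse is
Z + Z (t + s) / 2 ([inv_P2]). *)

(** * Square-free integers, parity and cyclic subgroups of Q *)

(** The square of the denominator of r is prime to that of its numerator, hence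
divides d. *)
Lemma square_free_rat_int (d : nat) (r : rat) (n : int) :
  square_free d -> r ^+ 2 * d%:R = n%:~R -> exists k : int, r = k%:~R.
Proof.
move=> sqf e.
have eZ : (numq r) ^+ 2 * d%:Z = n * (denq r) ^+ 2.
  apply: (@intr_inj rat); rewrite [LHS]intrM [RHS]intrM !(rmorphXn intr) /= -e.
  by rewrite numqE -pmulrn; ring.
have : (`|denq r| ^ 2 %| d)%N.
  rewrite -(@Gauss_dvdr _ (`|numq r| ^ 2)); last first.
    by rewrite coprimeXl // coprimeXr // coprime_sym coprime_num_den.
  have := congr1 absz eZ; rewrite (abszM _ d) (abszM n) !abszX absz_nat => ->.
  exact: dvdn_mull.
move/sqf => den1; exists (numq r); rewrite -{1}[r]divq_num_den.
have -> : denq r = 1 by rewrite -absz_denq den1.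
by rewrite divr1.
Qed.

Lemma square_free_ratio (d l : nat) (r : rat) :
  (0 < l)%N -> square_free d -> square_free l -> l%:R = r ^+ 2 * d%:R -> l = d.
Proof.
move=> l0 sqd sql e.
have [|k rk] := @square_free_rat_int d r l%:Z sqd; first by rewrite -e.
have eN : l = (`|k| ^ 2 * d)%N.
  have : l%:Z = k ^+ 2 * d%:Z.
    by apply: (@intr_inj rat); rewrite rmorphM rmorphXn /= -rk -e.
  by move/(congr1 absz); rewrite (abszM _ d) abszX !absz_nat.
have k1 : `|k|%N = 1%N by apply: sql; rewrite eN dvdn_mulr.
by rewrite eN k1 mul1n.
Qed.

(** Multiplication by the common denominator M turns B into a subgroup of Z, where
Euclidean division by the least positive element applies. *)
Lemma bounded_denominator_cyclic (B : set rat) (M : int) (x0 : rat) :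
  M != 0 -> (forall x, B x -> exists z : int, M%:~R * x = z%:~R) ->
  (forall x y (k : int), B x -> B y -> B (x - k%:~R * y)) ->
  B x0 -> x0 != 0 ->
  exists g, [/\ B g, g != 0 & forall x, B x -> exists k : int, x = k%:~R * g].
Proof.
move=> M0 Bint Bsub Bx0 x00.
have M0' : M%:~R != 0 :> rat by rewrite intr_eq0.
pose P n := `[< (0 < n)%N /\ B (n%:R / M%:~R) >].
have exP : exists n, P n.
  have [z ez] := Bint _ Bx0.
  have ex0 : x0 = z%:~R / M%:~R by rewrite -ez mulrC mulKf.
  have z0 : z != 0 by apply: contra_neq x00 => z0; rewrite ex0 z0 mul0r.
  exists `|z|%N; apply/asboolP; split; first by rewrite absz_gt0.
  rewrite -[_%:R]/((`|z|%N : int)%:~R) abszE.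
  case: (ger0P z) => _; first by rewrite -ex0.
  (* The opposite of x0, obtained as x0 - 2 x0. *)
  by have := Bsub _ _ 2 Bx0 Bx0; congr (B _); rewrite ex0; field.
case: (ex_minnP exP) => n /asboolP[n0 Bn] nmin.
exists (n%:R / M%:~R); split=> //.
  by rewrite mulf_neq0 ?invr_eq0 // pnatr_eq0 -lt0n.
move=> x Bx; have [z ez] := Bint _ Bx.
have ex : x = z%:~R / M%:~R by rewrite -ez mulrC mulKf.
exists (z %/ n)%Z.
have em : x - (z %/ n)%Z%:~R * (n%:R / M%:~R) = (z %% n)%Z%:~R / M%:~R.
  have edz : z%:~R = (z %/ n)%Z%:~R * n%:R + (z %% n)%Z%:~R :> rat.
    by rewrite {1}(divz_eq z n) intrD intrM.
  by rewrite ex edz; field.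
have [m0|m0] := eqVneq (z %% n)%Z 0.
  by move: em; rewrite m0 mul0r => /eqP; rewrite subr_eq0 => /eqP.
have nZ0 : n%:Z != 0 by rewrite eqz_nat -lt0n.
have mge := modz_ge0 z nZ0.
have mlt : (z %% n)%Z < n%:Z by rewrite ltz_pmod.
have : P `|(z %% n)%Z|%N.
  apply/asboolP; split; first by rewrite absz_gt0.
  by rewrite -[_%:R]/((`|_|%N : int)%:~R) abszE ger0_norm // -em; apply: Bsub.
by move/nmin; lia.
Qed.

Lemma int_parity (m : int) : exists a, m = 2 * a \/ m = 2 * a + 1.
Proof. by exists (m %/ 2)%Z; lia. Qed.

Lemma even_mulz (a b c : int) : a * b = 2 * c ->
  (exists k, a = 2 * k) \/ (exists k, b = 2 * k).
Proof.
have [x [->|->]] := int_parity a; first by left; exists x.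
have [y [->|->]] := int_parity b; first by right; exists y.
by rewrite mulrDl mul1r mulrDr mulr1; lia.
Qed.

Lemma norm_form_mod4_12 (d : nat) (m k n : int) :
  (d %% 4 = 1)%N \/ (d %% 4 = 2)%N -> m ^+ 2 + d%:Z * k ^+ 2 = 4 * n ->
  exists a b, m = 2 * a /\ k = 2 * b.
Proof.
move=> hd; rewrite (divn_eq d 4) !expr2 PoszD PoszM.
have [a [->|->]] := int_parity m; have [b [->|->]] := int_parity k;
  first by exists a, b.
all: by case: hd => ->; lia.
Qed.

Lemma norm_form_mod4_3 (d : nat) (m k n : int) :
  (d %% 4 = 3)%N -> m ^+ 2 + d%:Z * k ^+ 2 = 4 * n -> exists a, m = 2 * a + k.
Proof.
move=> hd; rewrite (divn_eq d 4) !expr2 PoszD PoszM hd.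
have [a [->|->]] := int_parity m; have [b [->|->]] := int_parity k => e.
all: by [exists (a - b); lia | lia].
Qed.

(** * Coordinates and the trace form *)

(** The embedding of Q as an opaque ring morphism, so that simplification does not
turn the scalar a into the vector a *: 1. *)
Definition ratK (K : fieldExtType rat) : {rmorphism rat -> K} := in_alg K.

Lemma ratKE (K : fieldExtType rat) r : ratK K r = r%:A.
Proof. by []. Qed.

#[local] Opaque ratK.

Section ImaginaryQuadratic.
Variables (d : nat) (K : splittingFieldType rat) (iota : {rmorphism K -> algC}).
Variable s : K.
Hypotheses (d0 : (0 < d)%N) (hs : s ^+ 2 = - d%:R).
Hypothesis hK : <<1; s>>%VS = {:K}%VS.

Local Notation conj := (conjK iota).
Local Notation q := (ratK K).

Lemma natK_eq0 n : (n%:R == 0 :> K) = (n == 0%N).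
Proof. by rewrite -(rmorph_nat q) fmorph_eq0 pnatr_eq0. Qed.

Lemma gen_neq0 : s != 0.
Proof.
apply/eqP => s0; move/eqP: hs.
by rewrite s0 expr0n /= eq_sym oppr_eq0 natK_eq0 eqn0Ngt d0.
Qed.

(** The number iota s is not real, since its square is negative; so its conjugate
is the other root of X^2 + d. *)
Lemma conjK_gen : conj s = - s.
Proof.
have e2 : (iota s) ^+ 2 = - d%:R by rewrite -rmorphXn hs rmorphN rmorph_nat.
have : (iota s)^* ^+ 2 == (iota s) ^+ 2.
  by rewrite -[X in X == _]rmorphXn e2 rmorphN rmorph_nat.
rewrite eqf_sqr => /orP[|] /eqP e; last first.
  by apply: (fmorph_inj iota); rewrite conjKE e rmorphN.
have : 0 <= (iota s) ^+ 2 by rewrite expr2 -{2}e mul_conjC_ge0.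
by rewrite e2 oppr_ge0 lern0 eqn0Ngt d0.
Qed.

Lemma conjK_rat r : conj (q r) = q r.
Proof. by rewrite ratKE [LHS]linearZ /= rmorph1. Qed.

Lemma coord (x : K) : exists a b : rat, x = q a + q b * s.
Proof.
have szn : (adjoin_degree 1 s <= 2)%N.
  have p0 : 'X^2 + d%:R%:P != 0 :> {poly K}.
    by rewrite monic_neq0 // monicXnaddC.
  have := @minPoly_dvdp _ _ 1 s ('X^2 + d%:R%:P) _ _.
  rewrite rpredD ?rpredX ?polyOverX ?polyOverC ?rpred_nat // => /(_ isT).
  rewrite /root !hornerE hs addNr eqxx => /(_ isT) /(dvdp_leq p0).
  by rewrite size_minPoly size_XnaddC.
have xK : x \in <<1; s>>%VS by rewrite hK memvf.
have := Fadjoin_poly_eq xK.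
have := Fadjoin_polyOver 1 s x.
have := size_Fadjoin_poly 1 s x.
set p := Fadjoin_poly _ _ _ => szp /polyOverP pK.
have [a ea] := vlineP _ _ (pK 0%N).
have [b eb] := vlineP _ _ (pK 1%N).
move=> <-; exists a, b; rewrite !ratKE (@horner_coef_wide _ 2 p) ?(leq_trans szp) //.
by rewrite !big_ord_recl big_ord0 /= ea eb expr0 expr1 mulr1 addr0.
Qed.

Lemma coord0 a b : q a + q b * s = 0 -> a = 0 /\ b = 0.
Proof.
move=> e.
have b0 : b = 0.
  apply: contraPeq e => b0 e.
  have e2 : q (a ^+ 2 + d%:R * b ^+ 2) = 0.
    rewrite rmorphD rmorphM !rmorphXn rmorph_nat.
    have -> : q a = - q b * s by rewrite mulNr; apply/eqP; rewrite -addr_eq0 e.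
    rewrite exprMn hs; ring.
  move/eqP: e2; rewrite fmorph_eq0 => /eqP e2.
  have : 0 < d%:R * b ^+ 2 by rewrite mulr_gt0 ?ltr0n // exprn_even_gt0.
  have := sqr_ge0 a; lra.
split=> //; move/eqP: e; rewrite b0 rmorph0 mul0r addr0 fmorph_eq0.
by move/eqP.
Qed.

(** A Galois automorphism is determined by its value at s, which is s or - s; so
the group consists of the identity and of complex conjugation. *)
Lemma galTraceE (x : K) : galTrace 1 {:K} x = x + conj x.
Proof.
have hom : kHom 1 {:K} (linfun (conjK iota)).
  apply/kHom_lrmorphism; split=> [y z|]; rewrite !lfunE /= ?rmorphM ?rmorph1 //.
have [c cG ec] : exists2 c, c \in 'Gal({:K} / 1)%g & forall y, c y = conj y.
  have [|g gG e] := @kAut_to_gal _ _ 1 {:K} (linfun (conjK iota)).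
    by rewrite kAutfE.
  by exists g => // y; rewrite -e ?memvf // lfunE.
have s0 := gen_neq0.
have c1 : 1%g != c.
  apply/eqP => e; have := ec s; rewrite -e gal_id conjK_gen => /eqP.
  by rewrite -addr_eq0 -mulr2n -mulr_natl mulf_eq0 natK_eq0 (negPf s0).
rewrite /galTrace (bigD1 1%g) ?group1 //= gal_id (bigD1 c) /=; last first.
  by rewrite cG eq_sym.
rewrite ec big1 ?addr0 // => g /andP[/andP[gG g1] gc].
have ge (h : gal_of {:K}) : g s = h s -> g = h.
  move=> e; apply/eqP/gal_eqP => y _; have [a [b ->]] := coord y.
  have galq (f : gal_of {:K}) r : f (q r) = q r.
    by rewrite ratKE [LHS]linearZ /= rmorph1.
  have galE (f : gal_of {:K}) : f (q a + q b * s) = q a + q b * f s.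
    by rewrite -{2}(galq f a) -{2}(galq f b) [LHS]rmorphD /= [X in _ + X]rmorphM.
  by rewrite !galE e.
have : (g s) ^+ 2 == s ^+ 2 by rewrite -rmorphXn hs rmorphN rmorph_nat.
rewrite eqf_sqr => /orP[|] /eqP e.
  by rewrite (ge 1%g) ?eqxx // gal_id in g1.
by rewrite (ge c) ?eqxx // ec conjK_gen in gc.
Qed.

(** * Algebraic integers of K *)

Local Notation O := (@ring_of_integers K).

Lemma conjK_id (x : K) : conj (conj x) = x.
Proof. by apply: (fmorph_inj iota); rewrite !conjKE conjCK. Qed.

Lemma integer_int (n : int) : O n%:~R.
Proof. exact: integral_id. Qed.

Lemma integer_add (x y : K) : O x -> O y -> O (x + y).
Proof. exact: integral_add. Qed.

Lemma integer_mul (x y : K) : O x -> O y -> O (x * y).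
Proof. exact: integral_mul. Qed.

Lemma integer_conj (x : K) : O x -> O (conj x).
Proof.
case=> p pm pr; exists p => //.
have -> : map_poly (intr : int -> K) p = map_poly conj (map_poly intr p).
  by apply/polyP => i; rewrite !coef_map_id0 ?rmorph0 //= rmorph_int.
by rewrite fmorph_root.
Qed.

Lemma integer_rat (r : rat) : O (q r) -> exists n : int, r = n%:~R.
Proof.
case=> p pm pr.
have iq : iota (q r) = ratr r by rewrite -[LHS]/((iota \o q) r) fmorph_eq_rat.
have /intrP[n en] : iota (q r) \in Num.int.
  apply: Cint_rat_Aint; first by rewrite iq Crat_rat.
  have := pr; rewrite -(fmorph_root iota) => /root_monic_Aint; apply.
    by rewrite map_monic monic_map.
  apply/polyOverP => i.
  by rewrite coef_map coef_map_id0 ?rmorph0 //= rmorph_int intr_int.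
exists n; apply: (fmorph_inj (iota \o q)).
by rewrite [LHS]en [RHS](rmorph_int (iota \o q)).
Qed.

Lemma conj_coord a b : conj (q a + q b * s) = q a - q b * s.
Proof. by rewrite rmorphD rmorphM /= !conjK_rat conjK_gen mulrN. Qed.

Lemma normE a b :
  (q a + q b * s) * conj (q a + q b * s) = q (a * a + d%:R * (b * b)).
Proof.
rewrite conj_coord !(rmorphD, rmorphM) rmorph_nat.
by transitivity (q a ^+ 2 - s ^+ 2 * q b ^+ 2); [|rewrite hs]; ring.
Qed.

(** Here m is the trace of x and n its norm.  Then (2 b)^2 d = 4 n - m^2 is an
integer, where b is the coordinate of x on s, and this forces 2 b to be an
integer because d is square-free. *)
Lemma integer_coord (x : K) : square_free d -> O x ->
  exists m k n : int, 2 * x = m%:~R + k%:~R * s /\ m ^+ 2 + d%:Z * k ^+ 2 = 4 * n.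
Proof.
move=> sqd Ox; have [a [b ex]] := coord x.
have ec : conj x = q a - q b * s by rewrite ex conj_coord.
have [m em] : exists m : int, 2 * a = m%:~R.
  apply: integer_rat; rewrite rmorphM rmorph_nat /=.
  have -> : 2 * q a = x + conj x by rewrite ec ex; ring.
  by apply: integer_add => //; apply: integer_conj.
have [n en] : exists n : int, a ^+ 2 + d%:R * b ^+ 2 = n%:~R.
  apply: integer_rat.
  have -> : q (a ^+ 2 + d%:R * b ^+ 2) = x * conj x.
    rewrite !expr2 !(rmorphD, rmorphM) rmorph_nat /= ec ex.
    by transitivity (q a ^+ 2 - s ^+ 2 * q b ^+ 2); [rewrite hs|]; ring.
  by apply: integer_mul => //; apply: integer_conj.
have [|k ek] := @square_free_rat_int d (2 * b) (4 * n - m ^+ 2) sqd.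
  by rewrite !expr2 intrB !intrM -em -en; ring.
exists m, k, n; split.
  by rewrite -!(rmorph_int q) -em -ek ex !rmorphM !rmorph_nat /=; ring.
apply: (@intr_inj rat).
by rewrite !expr2 intrD !intrM -em -ek -en -pmulrn; ring.
Qed.

Lemma integer_gen : O s.
Proof.
exists ('X^2 + d%:R%:P); first by rewrite monicXnaddC.
rewrite rmorphD rmorphXn /= map_polyX map_polyC /= /root !hornerE hs.
by rewrite rmorph_nat addNr.
Qed.

Lemma integer_half : (d %% 4 = 3)%N -> O ((1 + s) / 2).
Proof.
move=> d3; have n2 : 2 != 0 :> K by rewrite natK_eq0.
(* The norm (1 + d) / 4; the polynomial below is X^2 - X + (1 + d) / 4. *)
pose e : int := (d %/ 4).+1.
exists ('X^2 - 'X + e%:P).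
  rewrite -addrA monicE lead_coefDl ?lead_coefXn // size_polyXn.
  rewrite (leq_ltn_trans (size_polyD _ _)) // size_polyN size_polyX gtn_max /=.
  by rewrite (leq_ltn_trans (size_polyC_leq1 _)).
rewrite rmorphD rmorphB rmorphXn /= map_polyX map_polyC /= /root !hornerE.
have ed : d%:R = 4 * e%:~R - 1 :> K.
  have -> : d = ((d %/ 4).+1 * 4 - 1)%N by have := divn_eq d 4; lia.
  by rewrite natrB // natrM /e -pmulrn; ring.
have e2 : ((1 + s) / 2) ^+ 2 = (1 + s) / 2 - e%:~R.
  apply: (mulfI n2); apply: (mulfI n2).
  transitivity (1 + 2 * s + s ^+ 2); first by field.
  by rewrite hs ed; field.
by rewrite e2; apply/eqP; ring.
Qed.

(** * Lattices of rank two and their duals *)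

Definition lattice (u v : K) : set K :=
  [set x | exists i j : int, x = i%:~R * u + j%:~R * v].

Lemma lattice_l u v : lattice u v u.
Proof. by exists 1, 0; rewrite mul1r mul0r addr0. Qed.

Lemma lattice_r u v : lattice u v v.
Proof. by exists 0, 1; rewrite mul1r mul0r add0r. Qed.

(** Coordinates of elements of I have bounded denominators, so both the subgroup
of rational elements of I and the projection of I on the s-axis are cyclic;
take a generator u of the former and a v that projects to a generator of the
latter. *)
Lemma fractional_ideal_basis (I : set K) : square_free d ->
  fractional_ideal I -> exists u v (r : rat),
    [/\ I = lattice u v, r != 0 & u * conj v - conj u * v = q r * s].
Proof.
move=> sqd [[I0 ID IM] [x0 Ix0 x00] [c [Oc c0] Ic]].
have cc0 : conj c != 0 by rewrite fmorph_eq0.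
have [N eN] : exists N : int, c * conj c = N%:~R.
  have [a [b ec]] := coord c.
  have Occ : O (c * conj c) by apply: integer_mul => //; apply: integer_conj.
  have ecc : c * conj c = q (a * a + d%:R * (b * b)) by rewrite {1 2}ec normE.
  have [N eN] : exists n : int, a * a + d%:R * (b * b) = n%:~R.
    by apply: integer_rat; rewrite -ecc.
  by exists N; rewrite ecc eN rmorph_int.
have N0 : N != 0.
  by apply: contra_neq (mulf_neq0 c0 cc0) => N0; rewrite eN N0.
have IN x : I x -> O (N%:~R * x).
  move=> Ix; rewrite -eN (mulrC c) -mulrA.
  by apply: integer_mul; [apply: integer_conj | apply: Ic].
have M0 : 2 * N != 0 by rewrite mulf_neq0.
have Icoord a b : I (q a + q b * s) -> exists m k : int,
    (2 * N)%:~R * a = m%:~R /\ (2 * N)%:~R * b = k%:~R.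
  move=> /IN /(integer_coord sqd) [m [k [n [e _]]]].
  exists m, k.
  have : q ((2 * N)%:~R * a - m%:~R) + q ((2 * N)%:~R * b - k%:~R) * s = 0.
    rewrite !intrM !(rmorphB, rmorphM, rmorph_int).
    by rewrite -[RHS](subrr (2 * (N%:~R * (q a + q b * s)))) {2}e; ring.
  by move/coord0 => [/eqP + /eqP]; rewrite !subr_eq0 => /eqP -> /eqP ->.
have IZ k x : I x -> I (k%:~R * x) by apply: IM; apply: integer_int.
have IB k x y : I x -> I y -> I (x - k%:~R * y).
  by move=> Ix Iy; rewrite -mulNr -rmorphN; apply: ID => //; apply: IZ.
(* The rational r is c c' x0 x0', the multiple of x0 by the integer c (c x0)';
   since s is integral, r s is also in I. *)
have [r [r0 Ir Irs]] : exists r, [/\ r != 0, I (q r) & I (q r * s)].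
  have [a [b ex]] := coord x0.
  have er : x0 * conj x0 = q (a * a + d%:R * (b * b)) by rewrite {1 2}ex normE.
  have Ir : I (q (N%:~R * (a * a + d%:R * (b * b)))).
    rewrite rmorphM rmorph_int -er -eN.
    have -> : c * conj c * (x0 * conj x0) = c * conj (c * x0) * x0.
      by rewrite rmorphM; ring.
    apply: IM => //; apply: integer_mul => //.
    by apply: integer_conj; apply: Ic.
  exists (N%:~R * (a * a + d%:R * (b * b))); split=> //.
    rewrite -(fmorph_eq0 q) rmorphM -er rmorph_int.
    by rewrite !mulf_neq0 // ?fmorph_eq0 // -(rmorph_int q) fmorph_eq0 intr_eq0.
  by rewrite mulrC; apply: IM => //; apply: integer_gen.
pose A : set rat := [set a | I (q a)].
pose B : set rat := [set b | exists a, I (q a + q b * s)].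
have [||||g [Ag g0 gen]] := @bounded_denominator_cyclic A (2 * N) r M0.
- move=> a Aa; have [|m [_ [-> _]]] := Icoord a 0; last by exists m.
  by rewrite rmorph0 mul0r addr0.
- by move=> x y k Ax Ay; rewrite /A /= rmorphB rmorphM rmorph_int; apply: IB.
- exact: Ir.
- exact: r0.
have [||||h [[e Bh] h0 genh]] := @bounded_denominator_cyclic B (2 * N) r M0.
- by move=> b [a Iab]; have [_ [k [_ ->]]] := Icoord a b Iab; exists k.
- move=> x y k [a Ax] [b Ay]; exists (a - k%:~R * b).
  have := IB k _ _ Ax Ay; congr (I _).
  by rewrite !(rmorphB, rmorphM, rmorph_int); ring.
- by exists 0; rewrite rmorph0 add0r.
- exact: r0.
exists (q g), (q e + q h * s), (- 2 * g * h); split; last first.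
- by rewrite conj_coord conjK_rat !(rmorphM, rmorphN) rmorph_nat; ring.
- by rewrite !mulf_neq0.
apply/seteqP; split=> [x Ix|_ [i [j ->]]]; last by apply: ID; apply: IZ.
have [a [b ex]] := coord x.
have [j ej] : exists j : int, b = j%:~R * h by apply: genh; exists a; rewrite -ex.
have [i ei] : exists i : int, a - j%:~R * e = i%:~R * g.
  apply: gen; have := IB j _ _ Ix Bh; congr (I _).
  by rewrite ex ej !(rmorphB, rmorphM, rmorph_int); ring.
exists i, j; rewrite -!(rmorph_int q) -rmorphM -ei ex ej.
by rewrite !(rmorphB, rmorphM); ring.
Qed.

Lemma trace_formE x y : trace_form iota 1 x y = x * conj y + conj x * y.
Proof. by rewrite /trace_form mul1r galTraceE rmorphM /= conjK_id. Qed.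

(** If x pairs to m with u and to n with v, then w x = n u - m v: this is Cramer's
rule for the system formed by the two pairings, in the unknowns x and x'. *)
Lemma dual_latticeE u v (w := u * conj v - conj u * v) (x : K) : w != 0 ->
  dual_ideal iota (lattice u v) 1 x <-> lattice u v (w * x).
Proof.
move=> w0; have cw : conj w = - w.
  by rewrite /w !(rmorphB, rmorphM) /= !conjK_id; ring.
split=> [Dx|[n [m e]] _ [i [j ->]]].
  have [m] := Dx _ (lattice_l u v); rewrite trace_formE => em.
  have [n] := Dx _ (lattice_r u v); rewrite trace_formE => en.
  by exists n, (- m); rewrite mulrNz -em -en /w; ring.
exists (i * - m + j * n); rewrite trace_formE.
have ec : - w * conj x = n%:~R * conj u + m%:~R * conj v.
  by rewrite -cw -rmorphM e rmorphD !rmorphM !rmorph_int.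
apply: (mulfI w0); rewrite mulrDr !mulrA e (mulrC w) -[conj x * w]opprK.
rewrite -mulrN (mulrC (conj x)) ec rmorphD !rmorphM !rmorph_int /w.
by rewrite intrD !intrM mulrNz; ring.
Qed.

(** Multiplying the basis by e multiplies w by the norm of e, while an integer
change of vectors multiplies it by the determinant of the change. *)
Lemma lattice_stable_norm u v (w := u * conj v - conj u * v) (e : K) : w != 0 ->
  (forall x, lattice u v x -> lattice u v (e * x)) ->
  exists n : int, e * conj e = n%:~R.
Proof.
move=> w0 st.
have [a [b eu]] := st _ (lattice_l u v).
have [c [f ev]] := st _ (lattice_r u v).
exists (a * f - b * c); apply: (mulIf w0).
transitivity ((e * u) * conj (e * v) - conj (e * u) * (e * v)).
  by rewrite !rmorphM /w; ring.
by rewrite eu ev intrB !intrM !(rmorphD, rmorphM, rmorph_int) /w; ring.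
Qed.

(** The equation I = beta I^* says that w / beta multiplies I onto itself, so l and
the norm r ^ 2 d of w agree up to a unit m of Z; and m = 1 because both
are positive. *)
Lemma Arakelov_modular_level l (I : set K) :
  (0 < l)%N -> square_free d -> square_free l ->
  Arakelov_modular iota l I 1 -> l = d.
Proof.
move=> l0 sqd sql [[fI _ _] [b [b0 eI el]]].
have [u [v [r [eL r0 ew]]]] := fractional_ideal_basis sqd fI.
set w := _ - _ in ew.
have s0 := gen_neq0.
have w0 : w != 0 by rewrite ew mulf_neq0 // fmorph_eq0.
have Lb y : lattice u v y <-> lattice u v (w / b * y).
  rewrite -mulrA -(@dual_latticeE u v _ w0) -eL mulrC; split=> [|D].
    by rewrite {1}eI => -[x Dx <-]; rewrite mulrC mulKf.
  by rewrite eI; exists (y / b) => //; rewrite mulrC divfK.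
have [n en] := @lattice_stable_norm u v _ w0 (fun y => (Lb y).1).
have [m em] : exists m : int, b / w * conj (b / w) = m%:~R.
  apply: (@lattice_stable_norm u v _ w0) => y Ly; apply/Lb.
  suff -> : w / b * (b / w * y) = y by [].
  by field; rewrite b0 w0.
have cw : w * conj w = q (r * r * d%:R).
  by rewrite ew -[q r * s]add0r -(rmorph0 q) normE mul0r add0r mulrC.
have nm : n * m = 1.
  apply: (@intr_inj rat); apply: (fmorph_inj q).
  rewrite intrM rmorphM !rmorph_int -en -em !rmorphM !fmorphV rmorph1.
  by field; rewrite ?fmorph_eq0 b0 w0.
have elm : l%:R = m%:~R * (r ^+ 2 * d%:R) :> rat.
  apply: (fmorph_inj q); rewrite expr2 rmorphM rmorph_int rmorph_nat -cw el -em.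
  by rewrite rmorphM fmorphV; field; rewrite ?fmorph_eq0 w0.
have m1 : m = 1.
  have m0 : 0 < m%:~R :> rat.
    rewrite -(@pmulr_lgt0 _ (r ^+ 2 * d%:R)) -?elm ?ltr0n //.
    by rewrite mulr_gt0 ?ltr0n // exprn_even_gt0.
  have : (m %| 1)%Z by apply/dvdzP; exists n.
  by move: m0; rewrite ltr0z dvdz1; lia.
by apply: (@square_free_ratio d l r) => //; rewrite elm m1 mul1r.
Qed.

(** * Modular lattices from a basis (1, om) *)

Lemma totally_positive1 : totally_positive iota 1.
Proof. by move=> f _; rewrite !rmorph1 ltr01. Qed.

(** For the basis (1, om) the element w is - s, whose norm is d; hence beta = - s. *)
Lemma Arakelov_modular_lattice om : om - conj om = s ->
  fractional_ideal (lattice 1 om) -> Arakelov_modular iota d (lattice 1 om) 1.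
Proof.
move=> eom fI; split.
  by split=> //; [exact: oner_neq0 | exact: totally_positive1].
have s0 := gen_neq0.
have ns0 : - s != 0 by rewrite oppr_eq0.
have ew : 1 * conj om - conj 1 * om = - s by rewrite rmorph1 -eom; ring.
exists (- s); split=> //; last first.
  by rewrite [conj (- s)]rmorphN /= conjK_gen opprK mulNr -expr2 hs opprK.
have DL x : dual_ideal iota (lattice 1 om) 1 x <-> lattice 1 om (- s * x).
  by rewrite -ew; apply: dual_latticeE; rewrite ew.
apply/seteqP; split=> [y Iy|_ [x /DL Dx <-] //].
exists (y / - s); last by rewrite mulrC divfK.
by apply/DL; rewrite mulrC divfK.
Qed.

Lemma fractional_ideal_integers : fractional_ideal O.
Proof.
split; first split=> *.
- exact: (integer_int 0).
- exact: integer_add.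
- exact: integer_mul.
- by exists 1; [exact: (integer_int 1) | exact: oner_neq0].
exists 1; first by split; [exact: (integer_int 1) | exact: oner_neq0].
by move=> x; rewrite mul1r.
Qed.

Lemma fractional_ideal_inv (P : set K) z : P `<=` O -> P z -> z != 0 ->
  fractional_ideal (inv_ideal P).
Proof.
move=> PO Pz z0; split; first split.
- by move=> y _; rewrite mul0r; exact: (integer_int 0).
- move=> x y Px Py w Pw; rewrite mulrDl.
  by apply: integer_add; [apply: Px | apply: Py].
- move=> a x Oa Px w Pw; rewrite -mulrA.
  by apply: integer_mul => //; apply: Px.
- by exists 1; [move=> y /PO; rewrite mul1r | exact: oner_neq0].
by exists z; [split=> //; exact: PO | move=> x Px; rewrite mulrC; apply: Px].
Qed.

Lemma int_coord_inj (a b a' b' : int) :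
  a%:~R + b%:~R * s = a'%:~R + b'%:~R * s -> a = a' /\ b = b'.
Proof.
move=> e; have : q (a - a')%:~R + q (b - b')%:~R * s = 0.
  by rewrite !rmorph_int !intrB mulrBl addrACA -opprD e subrr.
by move/coord0 => [/eqP + /eqP]; rewrite !intr_eq0 !subr_eq0 => /eqP -> /eqP ->.
Qed.

Lemma two_neq0 : 2 != 0 :> K. Proof. by rewrite natK_eq0. Qed.

(** * The ring of integers for d = 3 modulo 4 *)

Lemma integers_3mod4 : square_free d -> (d %% 4 = 3)%N ->
  O = lattice 1 ((1 + s) / 2).
Proof.
move=> sqd d3; apply/seteqP.
split=> [x /(integer_coord sqd) [m [k [n [e]]]]|_ [i [j ->]]].
  move/(norm_form_mod4_3 d3) => [a em]; exists a, k.
  apply: (mulfI two_neq0); rewrite e em intrD intrM; field.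
  exact: two_neq0.
apply: integer_add; apply: integer_mul; try exact: integer_int.
  exact: (integer_int 1).
exact: integer_half.
Qed.

Lemma integers_modular : square_free d -> (d %% 4 = 3)%N ->
  Arakelov_modular iota d O 1.
Proof.
move=> sqd d3; rewrite integers_3mod4 //; apply: Arakelov_modular_lattice.
  rewrite rmorphM rmorphD fmorphV rmorph1 rmorph_nat /= conjK_gen; field.
  exact: two_neq0.
by rewrite -integers_3mod4 //; exact: fractional_ideal_integers.
Qed.

(** * The prime above 2 for d = 1 or 2 modulo 4 *)

Section Ramified2.
Hypotheses (sqd : square_free d) (hd : (d %% 4 = 1)%N \/ (d %% 4 = 2)%N).

(** The residue of d, taken so that t + s is the element of even norm among s and
1 + s; many identities below hold because t ^ 2 = t. *)
Let t : int := (d %% 2)%N.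

Lemma integers_12mod4 (x : K) : O x <-> exists a b : int, x = a%:~R + b%:~R * s.
Proof.
split=> [/(integer_coord sqd) [m [k [n [e]]]]|[a [b ->]]].
  move/(norm_form_mod4_12 hd) => [a [b [em ek]]]; exists a, b.
  by apply: (mulfI two_neq0); rewrite e em ek !intrM; ring.
apply: integer_add; first exact: integer_int.
by apply: integer_mul; [exact: integer_int | exact: integer_gen].
Qed.

Definition P2 := lattice 2 (t%:~R + s).

(** The prime is the kernel of the ring morphism a + b s |-> a + t b from O to
Z / 2. *)
Lemma P2E x : P2 x <->
  exists a b c : int, x = a%:~R + b%:~R * s /\ a + t * b = 2 * c.
Proof.
split=> [[i [j ->]]|[a [b [c [-> e]]]]].
  exists (2 * i + t * j), j, (i + t * j); split; last by ring.
  by rewrite intrD !intrM; ring.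
exists (c - t * b), b.
have -> : a = 2 * c - t * b by rewrite -e; ring.
by rewrite !intrB !intrM; ring.
Qed.

Lemma t01 : t = 0 \/ t = 1.
Proof. by rewrite /t; lia. Qed.

Let g : int := (d %/ 2)%N.

Lemma dE : d%:Z = 2 * g + t.
Proof. by rewrite /g /t; lia. Qed.

Lemma s2E : s * s = - (2 * g%:~R + t%:~R).
Proof. by rewrite -expr2 hs -[d%:R]/(d%:Z%:~R) dE intrD intrM. Qed.

Lemma P2_submodule : OK_submodule P2.
Proof.
split.
- by exists 0, 0; rewrite !mul0r addr0.
- move=> _ _ [i [j ->]] [i' [j' ->]]; exists (i + i'), (j + j').
  by rewrite !intrD; ring.
move=> _ _ /integers_12mod4 [e [f ->]] /P2E [a [b [c [-> h]]]]; apply/P2E.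
exists (e * a - (2 * g + t) * f * b), (e * b + f * a).
exists (e * c - g * f * b + t * f * (c - t * b)).
split.
  rewrite !(intrB, intrD, intrM).
  transitivity (e%:~R * a%:~R + (f%:~R * b%:~R) * (s * s)
      + (e%:~R * b%:~R + f%:~R * a%:~R) * s); first by ring.
  by rewrite s2E; ring.
have -> : a = 2 * c - t * b by rewrite -h; ring.
by case: t01 => ->; ring.
Qed.

Lemma P2_sub : P2 `<=` O.
Proof. by move=> _ /P2E [a [b [c [-> _]]]]; apply/integers_12mod4; exists a, b. Qed.

Lemma P2_int (n : int) : P2 n%:~R <-> (2%:Z %| n)%Z.
Proof.
rewrite P2E; split=> [[a [b [c [e h]]]]|/dvdzP [k ->]].
  have /int_coord_inj [-> b0] : n%:~R + 0%:~R * s = a%:~R + b%:~R * s.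
    by rewrite -e; ring.
  by apply/dvdzP; exists c; move: h; rewrite -b0; lia.
by exists (k * 2), 0, k; split; [ring | lia].
Qed.

Lemma P2_prime : prime_ideal P2.
Proof.
split; [exact: P2_submodule | exact: P2_sub | by move=> /(P2_int 1) |].
move=> _ _ /integers_12mod4 [a [b ->]] /integers_12mod4 [e [f ->]].
move=> /P2E [m [k [c [h em]]]].
have /int_coord_inj [m_ k_] : m%:~R + k%:~R * s =
    (a * e - (2 * g + t) * b * f)%:~R + (a * f + b * e)%:~R * s.
  rewrite -h !(intrB, intrD, intrM).
  transitivity (a%:~R * e%:~R + (b%:~R * f%:~R) * (s * s)
      + (a%:~R * f%:~R + b%:~R * e%:~R) * s); first by ring.
  by rewrite s2E; ring.
have /even_mulz [[x ex]|[x ex]] :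
    (a + t * b) * (e + t * f) = 2 * (c + g * b * f + t * b * f).
- transitivity (2 * c + 2 * (g * b * f + t * b * f)); last by ring.
  by rewrite -em m_ k_; case: t01 => ->; ring.
- by left; apply/P2E; exists a, b, x.
- by right; apply/P2E; exists e, f, x.
Qed.

(** A prime Q above 2 contains t + s, whose square is a multiple of 2, hence
contains P2; conversely an element a + b s of Q is congruent modulo t + s to
the integer a - t b, which must then be even. *)
Lemma P2_unique : unique (prime_ideal_above 2) P2.
Proof.
split; first by split; [exact: P2_prime | exact: P2_int].
move=> Q [[[Q0 QD QM] QO Q1 Qprime] Qint].
have Q2 : Q 2 by apply/(Qint 2).
have OI (a b : int) : O (a%:~R + b%:~R * s) by apply/integers_12mod4; exists a, b.
have Qts : Q (t%:~R + s).
  have Ots : O (t%:~R + s) by have := OI t 1; rewrite mul1r.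
  suff : Q (t%:~R + s) \/ Q (t%:~R + s) by case.
  apply: Qprime => //.
  have -> : (t%:~R + s) * (t%:~R + s) = ((- g)%:~R + t%:~R * s) * 2.
    transitivity (t%:~R * t%:~R + s * s + 2 * t%:~R * s); first by ring.
    by rewrite s2E -intrM mulrNz; case: t01 => ->; rewrite ?mulr0 ?mul1r; ring.
  exact: QM.
have P2Q : P2 `<=` Q.
  by move=> _ [i [j ->]]; apply: QD; apply: QM => //; apply: integer_int.
apply/seteqP; split=> // x Qx.
have /integers_12mod4 [a [b ex]] := QO _ Qx.
have : Q (a - t * b)%:~R.
  have -> : (a - t * b)%:~R = x + (- b)%:~R * (t%:~R + s).
    by rewrite ex intrB intrM mulrNz; ring.
  by apply: QD => //; apply: QM => //; apply: integer_int.
move=> /Qint /dvdzP [k ek]; apply/P2E; exists a, b, (k + t * b); split=> //.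
have -> : a = k * 2 + t * b by rewrite -ek; ring.
by ring.
Qed.

(** The square of P2 is 2 O, so that its inverse is P2 / 2. *)
Lemma inv_P2 : inv_ideal P2 = lattice 1 ((t%:~R + s) / 2).
Proof.
have n2 := two_neq0.
apply/seteqP; split=> [x xP|_ [i [j ->]] _ [k [l ->]]].
  have /integers_12mod4 [a [b e2]] : O (x * 2).
    by apply: xP; apply/(P2_int 2).
  have /integers_12mod4 [A [B ets]] : O (x * (t%:~R + s)).
    by apply: xP; exact: lattice_r.
  have /int_coord_inj [_ eB] : (2 * A)%:~R + (2 * B)%:~R * s =
      (t * a - (2 * g + t) * b)%:~R + (a + t * b)%:~R * s.
    transitivity (2 * (x * (t%:~R + s))); first by rewrite ets !intrM; ring.
    transitivity (x * 2 * (t%:~R + s)); first by ring.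
    rewrite e2 !(intrB, intrD, intrM).
    transitivity (t%:~R * a%:~R + b%:~R * (s * s) + (a%:~R + t%:~R * b%:~R) * s).
      by ring.
    by rewrite s2E; ring.
  exists (B - t * b), b; apply: (mulIf n2); rewrite e2.
  have -> : a = 2 * B - t * b by rewrite eB; ring.
  by rewrite !intrB !intrM; field.
apply/integers_12mod4.
exists (i * (2 * k + t * l) + j * (t * k - g * l)), (i * l + j * (k + t * l)).
apply: (mulIf n2).
transitivity (2 * i%:~R * (k%:~R * 2 + l%:~R * (t%:~R + s))
    + j%:~R * (2 * k%:~R * (t%:~R + s)
      + l%:~R * (t%:~R * t%:~R + s * s + 2 * t%:~R * s))); first by field.
rewrite s2E !(intrB, intrD, intrM).
by case: t01 => ->; ring.
Qed.

Lemma P2_inv_modular : Arakelov_modular iota d (inv_ideal P2) 1.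
Proof.
rewrite inv_P2; apply: Arakelov_modular_lattice.
  rewrite rmorphM rmorphD fmorphV rmorph_int rmorph_nat /= conjK_gen; field.
  exact: two_neq0.
rewrite -inv_P2; apply: (fractional_ideal_inv (z := 2)) => //; last exact: two_neq0.
  exact: P2_sub.
exact/(P2_int 2).
Qed.

End Ramified2.

End ImaginaryQuadratic.

Unset Implicit Arguments.
Set Strict Implicit.

Theorem proposition3p3 (d : nat) (hd : (0 < d)%N) (sqfd : square_free d)
    (K : splittingFieldType rat) (iota : {rmorphism K -> algC})
    (sqrtNd : K) (hsqrt : sqrtNd ^+ 2 = - d%:R)
    (hK : <<1; sqrtNd>>%VS = {:K}%VS) :
  (forall l : nat, (0 < l)%N -> square_free l ->
     ((exists I : set K, Arakelov_modular iota l I 1) <-> l = d)) /\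
  ((d %% 4 = 1)%N \/ (d %% 4 = 2)%N ->
     exists P : set K, unique (prime_ideal_above 2) P /\
       Arakelov_modular iota d (inv_ideal P) 1) /\
  ((d %% 4 = 3)%N -> Arakelov_modular iota d (@ring_of_integers K) 1).
Proof.
have caseP : (d %% 4 = 1)%N \/ (d %% 4 = 2)%N ->
    exists P : set K, unique (prime_ideal_above 2) P /\
      Arakelov_modular iota d (inv_ideal P) 1.
  move=> d12; exists (P2 d sqrtNd); split.
    exact: P2_unique.
  exact: P2_inv_modular.
have caseO : (d %% 4 = 3)%N -> Arakelov_modular iota d (@ring_of_integers K) 1.
  exact: (integers_modular iota hd hsqrt hK sqfd).
split; last by [].
move=> l l0 sql; split=> [[I mI]|->].
  exact: (Arakelov_modular_level hd hsqrt hK l0 sqfd sql mI).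
have : (d %% 4 <> 0)%N by move/eqP => d4; have := sqfd 2%N d4.
have : (d %% 4 < 4)%N by rewrite ltn_mod.
case E: (d %% 4)%N => [|[|[|[|]]]] // _ _.
- by have [P [_ mP]] := caseP (or_introl E); exists (inv_ideal P).
- by have [P [_ mP]] := caseP (or_intror E); exists (inv_ideal P).
- by exists (@ring_of_integers K); exact: caseO.
Qed.
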